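(* Let $\Gamma$ be a set, $\lambda:\Gamma\to\Gamma$ a function, $K$ a non-trivial finite abelian group and suppose that the generalized shift $\sigma_\lambda:K^\Gamma\to K^\Gamma$, $\sigma_\lambda((x_i)_{i\in\Gamma})=(x_{\lambda(i)})_{i\in\Gamma}$, is injective. Then the following conditions are equivalent: (a) $\sigma_\lambda$ is locally periodic; (b) $\sigma_\lambda$ is periodic; (c) $\mathrm{ent}(\sigma_\lambda)=0$.
   Context: A function $f:X\to X$ is locally periodic (also called strongly recurrent) if every $x\in X$ is a periodic point, i.e. for every $x$ there is a positive integer $n$ with $f^n(x)=x$; $f$ is periodic if there is a positive integer $n$ with $f^n=\mathrm{id}_X$. Algebraic entropy: for an abelian group $G$, an endomorphism $\phi:G\to G$, a finite subgroup $F$ of $G$ and a positive integer $n$, let $T_n(\phi,F)=F+\phi(F)+\ldots+\phi^{n-1}(F)$, $H(\phi,F)=\lim_{n\to\infty}\frac{\log|T_n(\phi,F)|}{n}$ (the limit exists), and $\mathrm{ent}(\phi)=\sup\{H(\phi,F):F\text{ a finite subgroup of }G\}\in[0,\infty]$. *)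

(* Defs.v *)
From HB Require Import structures.
From mathcomp Require Import all_boot all_order all_algebra finmap.
From mathcomp Require Import all_classical all_reals all_analysis.

Set Implicit Arguments.
Unset Strict Implicit.
Unset Printing Implicit Defensive.

Import Order.TTheory GRing.Theory Num.Theory.
Import numFieldNormedType.Exports.

Local Open Scope classical_set_scope.
Local Open Scope ring_scope.

Definition locally_periodic_fun (X : Type) (f : X -> X) : Prop :=
  forall x : X, exists n : nat, (0 < n)%N /\ iter n f x = x.

Definition periodic_fun (X : Type) (f : X -> X) : Prop :=
  exists n : nat, (0 < n)%N /\ iter n f =1 id.

Definition finite_subgroup (G : zmodType) : set {fset G} :=
  [set F : {fset G} | zmod_closed (mem F)].

(* The trajectory F + phi(F) + ... + phi^(n-1)(F), with value {0} for n = 0. *)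
Fixpoint trajectory (G : zmodType) (phi : {additive G -> G}) (F : {fset G})
    (n : nat) : {fset G} :=
  if n is m.+1 then
    [fset (x + iter m phi y)%R | x in trajectory phi F m, y in F]%fset
  else [fset 0%R]%fset.

(* The term of index 0 of the sequence is 0 since x / 0 = 0, and it does not
   affect the limit. The limit exists whenever F is a finite subgroup. *)
Definition trajectory_entropy (R : realType) (G : zmodType)
    (phi : {additive G -> G}) (F : {fset G}) : R :=
  lim ((ln (#|` trajectory phi F n|%fset%:R : R) / n%:R) @[n --> \oo]).

Definition algebraic_entropy (R : realType) (G : zmodType)
    (phi : {additive G -> G}) : \bar R :=
  ereal_sup [set (trajectory_entropy R phi F)%:E | F in @finite_subgroup G].

Definition generalized_shift (Gamma : Type) (K : zmodType)
    (lambda : Gamma -> Gamma) (x : Gamma -> K) : Gamma -> K :=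
  fun i => x (lambda i).

Fact generalized_shift_is_zmod_morphism (Gamma : Type) (K : zmodType)
    (lambda : Gamma -> Gamma) :
  zmod_morphism (@generalized_shift Gamma K lambda).
Proof. by []. Qed.

HB.instance Definition _ (Gamma : Type) (K : zmodType)
    (lambda : Gamma -> Gamma) :=
  GRing.isZmodMorphism.Build (Gamma -> K) (Gamma -> K)
    (@generalized_shift Gamma K lambda)
    (generalized_shift_is_zmod_morphism lambda).

(* Main.v *)
(* If lambda is surjective and not periodic, there is a set A for which every n
   is the first hitting time n = min {m | lambda^m(x) in A} of some point x.
   Evaluating at these points shows that the indicator a of A, with values 0
   and k <> 0, is not a periodic point of the shift, and that the images of the
   finite subgroup K a under the iterates of the shift form a direct sum, so
   that its entropy is log |K| > 0.
   Conversely, the trajectories of a periodic endomorphism are bounded. *)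
From HB Require Import structures.
Require Import Defs.

From mathcomp Require Import all_boot all_order all_algebra finmap.
From mathcomp Require Import all_classical all_reals all_analysis.

Set Implicit Arguments.
Unset Strict Implicit.
Unset Printing Implicit Defensive.

Import Order.TTheory GRing.Theory Num.Theory.
Import numFieldNormedType.Exports.

Local Open Scope classical_set_scope.
Local Open Scope ring_scope.

(** * Iterates, orbits and hitting times of a self-map *)

Section IterFunctions.
Variables (T : Type) (f : T -> T).

Lemma iter_addn_fix (m n : nat) (x : T) :
  iter m f x = x -> iter (n + m) f x = iter n f x.
Proof. by move=> fx; rewrite iterD fx. Qed.

Lemma iter_muln_fix (m n : nat) (x : T) :
  iter m f x = x -> iter (n * m) f x = x.
Proof. by move=> fx; elim: n => // n IHn; rewrite mulSn iterD IHn. Qed.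

Lemma iter_modn (p m : nat) : iter p f =1 id -> iter (m %% p) f =1 iter m f.
Proof.
move=> fp x; rewrite [in RHS](divn_eq m p) addnC iter_addn_fix //.
exact: iter_muln_fix.
Qed.

Lemma iter_surj (n : nat) :
  (forall y, exists x, f x = y) -> forall y, exists x, iter n f x = y.
Proof.
move=> fS; elim: n => [y|n IHn y]; first by exists y.
have [z <-] := fS y; have [x <-] := IHn z.
by exists x.
Qed.

Definition forward_orbit (x : T) : set T :=
  [set y | exists n, iter n f x = y].

(** A periodic point [y] is reached again from [f y], so forward orbits are cycles and can serve as
    names for them. *)
Lemma forward_orbit_iter (n : nat) (x : T) :
  locally_periodic_fun f -> forward_orbit (iter n f x) = forward_orbit x.
Proof.
move=> f_lp; elim: n => // n IHn; rewrite iterS -{}IHn.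
move: (iter n f x) => {n}y; apply/seteqP; split=> z [m <-] /=.
  by exists m.+1; rewrite iterSr.
have [[|p] [//_ fy]] := f_lp y.
by exists (m + p)%N; rewrite -iterSr -addnS iter_addn_fix.
Qed.

(** Since [n!] is a multiple of every [d] in 1..n, a point moved by this iterate has no period up to
    [n]. *)
Lemma nonperiodic_fact (n : nat) :
  ~ periodic_fun f -> exists x, iter n`! f x <> x.
Proof.
move=> nper; apply/existsNP => fx; apply: nper; exists n`!.
by split=> //; exact: fact_gt0.
Qed.

Lemma iter_fact_fix (d n : nat) (x : T) :
  (0 < d <= n)%N -> iter d f x = x -> iter n`! f x = x.
Proof. by move=> /dvdn_fact/dvdnP[q ->]; exact: iter_muln_fix. Qed.

(* If some point i is not periodic, take A = {i}; otherwise the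
   orbits partition T into cycles of unbounded lengths, and A consists of one
   point of each cycle. *)
Lemma all_first_hitting_times :
    (forall y, exists x, f x = y) -> ~ periodic_fun f ->
  exists A : set T, forall n : nat, exists x : T,
    A (iter n f x) /\ forall m, (m < n)%N -> ~ A (iter m f x).
Proof.
move=> fS nper.
(* If [f^n x = y], a hit of [A] at time [m < n] could only be [y] itself, which would then have
   period [n - m]. *)
suff [A HA] : exists A : set T, forall n, exists y, [/\ A y,
    forall m l x, iter l f x = y -> A (iter m f x) -> iter m f x = y &
    forall d, (0 < d <= n)%N -> iter d f y <> y].
  exists A => n; have [y [Ay yA ny]] := HA n.
  have [x fx] := iter_surj n fS y; exists x; split=> [|m ltmn Am].
    by rewrite fx.
  apply: (ny (n - m)%N); first by rewrite subn_gt0 ltmn leq_subr.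
  by rewrite -[in LHS](yA _ _ _ fx Am) -iterD subnK // ltnW.
have [f_lp|/existsNP[y ny]] := pselect (locally_periodic_fun f); last first.
  exists [set y] => n; exists y; split=> // d /andP[d_gt0 _] fdy.
  by apply: ny; exists d.
(* Non-periodicity makes [T] inhabited; [x0] is only the value of the choice function at the empty
   set. *)
have [x0 _] := nonperiodic_fact 0 nper.
have nonempty_choice S : exists x : T, S !=set0 -> S x.
  by have [[x Sx]|nS] := pselect (S !=set0); [exists x | exists x0 => /nS].
have [c cP] := choice nonempty_choice.
have repP x : forward_orbit x (c (forward_orbit x)).
  by apply: cP; exists x, 0%N.
exists [set y | c (forward_orbit y) = y] => n.
have [i ni] := nonperiodic_fact n nper; have [k ik] := repP i.
exists (iter k f i); split=> [|m l x|d dn fd] /=.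
- by rewrite forward_orbit_iter.
- move=> fx <-; rewrite ik forward_orbit_iter // -(forward_orbit_iter l) //.
  by rewrite fx forward_orbit_iter.
- have [k' ki] : forward_orbit (iter k f i) i.
    by rewrite forward_orbit_iter //; exists 0%N.
  (* A period [d <= n] of the representative would make [f^(n!)] fix it, hence also [i], which lies
     further along the same cycle. *)
  apply: ni; rewrite -ki -iterD addnC iterD.
  by rewrite (iter_fact_fix dn fd).
Qed.

End IterFunctions.

(** * Trajectories and entropy of an endomorphism *)

Section Trajectory.
Variables (R : realType) (G : zmodType) (phi : {additive G -> G}).
Implicit Types F : {fset G}.

Lemma iter_additive_is_zmod_morphism (n : nat) : zmod_morphism (iter n phi).
Proof. by elim: n => // n IHn x y; rewrite !iterS IHn raddfB. Qed.

HB.instance Definition _ (n : nat) :=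
  GRing.isZmodMorphism.Build G G (iter n phi)
    (iter_additive_is_zmod_morphism n).

Lemma finite_subgroup0 F : finite_subgroup F -> 0 \in F.
Proof. by case. Qed.

Lemma finite_subgroupD F x y :
  finite_subgroup F -> x \in F -> y \in F -> x + y \in F.
Proof. by move=> /GRing.zmod_closedD[_ /[apply] /[apply]]. Qed.

Lemma trajectory_add F x y n :
  x \in trajectory phi F n -> y \in F ->
  x + iter n phi y \in trajectory phi F n.+1.
Proof. by move=> xT yF; apply/imfset2P; exists x => //; exists y. Qed.

Lemma trajectoryP F n z :
  z \in trajectory phi F n.+1 ->
  exists x y, [/\ x \in trajectory phi F n, y \in F & z = x + iter n phi y].
Proof. by case/imfset2P => x xT [y yF ->]; exists x, y. Qed.

Lemma trajectory0 F n : 0 \in F -> 0 \in trajectory phi F n.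
Proof.
move=> F0; elim: n => [|n IHn]; first by rewrite inE.
by rewrite -[0]addr0 -[X in _ + X](raddf0 (iter n phi)) trajectory_add.
Qed.

(** The new term is absorbed by the summand of index [m], as [F] is closed under addition. *)
Lemma trajectoryD_iter F x y m n : finite_subgroup F -> (m < n)%N ->
  x \in trajectory phi F n -> y \in F ->
  x + iter m phi y \in trajectory phi F n.
Proof.
move=> Fsub + + yF; elim: n x => // n IHn x.
rewrite ltnS leq_eqVlt => + /trajectoryP[x' [z [x'T zF ->]]].
case/orP=> [/eqP -> | ltmn].
  by rewrite -addrA -raddfD trajectory_add // finite_subgroupD.
by rewrite addrAC trajectory_add // IHn.
Qed.

(** Exponents reduce modulo [p], so every summand already occurs among the first [p]. *)
Lemma trajectory_sub_period F p n : (0 < p)%N -> iter p phi =1 id ->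
  finite_subgroup F -> (trajectory phi F n `<=` trajectory phi F p)%fset.
Proof.
move=> p_gt0 phip Fsub; elim: n => [|n /fsubsetP IHn]; apply/fsubsetP => x.
  by rewrite inE => /eqP ->; apply: trajectory0; exact: finite_subgroup0.
case/trajectoryP => x' [y [/IHn x'T yF ->]].
by rewrite -(iter_modn n phip) trajectoryD_iter // ltn_mod.
Qed.

Lemma trajectory_entropy_bounded F C : 0 \in F ->
  (forall n, (#|` trajectory phi F n| <= C)%N) ->
  trajectory_entropy R phi F = 0.
Proof.
move=> F0 leC; apply/cvg_lim => //.
have T_gt0 n : (0 < #|` trajectory phi F n|)%N.
  by rewrite cardfs_gt0; apply/fset0Pn; exists 0; exact: trajectory0.
apply: (@squeeze_cvgr _ _ _ _ (cst 0) (fun n => ln C%:R * n%:R^-1)).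
- apply: nearW => n; rewrite divr_ge0 ?ln_ge0 ?ler1n //=.
  rewrite ler_wpM2r ?invr_ge0 // ler_ln ?posrE ?ltr0n ?ler_nat //.
  exact: leq_trans (T_gt0 n) (leC n).
- exact: cvg_cst.
- rewrite -[X in _ --> X](mulr0 (ln C%:R)); apply: cvgMr.
  (* The harmonic sequence is 1/(n+1), hence the shift of index. *)
  rewrite -(cvg_shiftS (fun n => n%:R^-1 : R)); exact: cvg_harmonic.
Qed.

Lemma trajectory_entropy_exponential F q : (0 < q)%N ->
  (forall n, #|` trajectory phi F n| = (q ^ n)%N) ->
  trajectory_entropy R phi F = ln q%:R.
Proof.
move=> q_gt0 Tq; apply/cvg_lim => //.
(* The quotient is constant only from index 1 on: at 0 it is 0. *)
apply: cvg_near_cst; exists 1%N => // n /= n_gt0.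
rewrite Tq natrX lnXn ?ltr0n //.
by rewrite -[X in X / _]mulr_natr mulfK // pnatr_eq0 -lt0n.
Qed.

(** The hypothesis makes addition injective on pairs from [T_n] and [F], so each step multiplies the
    cardinality by that of [F]. *)
Lemma card_trajectory_direct F :
    (forall n x x' y y',
       x \in trajectory phi F n -> x' \in trajectory phi F n ->
       y \in F -> y' \in F ->
       x + iter n phi y = x' + iter n phi y' -> y = y') ->
  forall n, #|` trajectory phi F n| = (#|` F| ^ n)%N.
Proof.
move=> dir; elim=> [|n IHn]; first by rewrite cardfs1.
rewrite (perm_size (enum_imfset2 _ _)) /=; last first.
  move=> [x y] [x' y'] /andP[/= xT yF] /andP[/= x'T y'F] eqz.
  have eqy := dir _ _ _ _ _ xT x'T yF y'F eqz.
  by move: eqz; rewrite eqy => /addIr ->.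
by rewrite size_allpairs expnSr -IHn.
Qed.

Lemma algebraic_entropy_periodic :
  periodic_fun phi -> algebraic_entropy R phi = 0%E.
Proof.
move=> [p [p_gt0 phip]].
have H0 F : finite_subgroup F -> trajectory_entropy R phi F = 0.
  move=> Fsub; apply: (@trajectory_entropy_bounded _ #|` trajectory phi F p|).
    exact: finite_subgroup0.
  by move=> n; apply: fsubset_leq_card; exact: trajectory_sub_period.
rewrite /algebraic_entropy -[RHS]ereal_sup1; congr ereal_sup.
apply/seteqP; split=> [_ [F Fsub <-]|_ ->] /=; first by rewrite H0.
(* The trivial subgroup shows that the value 0 is attained; the supremum of an empty set would be
   -oo. *)
have F0 : finite_subgroup [fset (0 : G)]%fset.
  by split=> [|x y]; rewrite !inE // => /eqP -> /eqP ->; rewrite subrr.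
by exists [fset 0]%fset => //; rewrite H0.
Qed.

End Trajectory.

(** * Generalized shifts and indicator functions *)

Section Shift.
Variables (Gamma : Type) (lambda : Gamma -> Gamma) (K : finZmodType).
Local Notation shift := (@generalized_shift Gamma K lambda).

Lemma iter_shiftE n x i : iter n shift x i = x (iter n lambda i).
Proof.
by elim: n i => // n IHn i; rewrite iterS /generalized_shift IHn -iterSr.
Qed.

Definition indicator (A : set Gamma) (k : K) : Gamma -> K :=
  fun i => if `[< A i >] then k else 0.

Lemma indicatorT A k i : A i -> indicator A k i = k.
Proof. by rewrite /indicator => /asboolT ->. Qed.

Lemma indicatorF A k i : ~ A i -> indicator A k i = 0.
Proof. by rewrite /indicator => /asboolF ->. Qed.

Lemma indicatorB A k l : indicator A (k - l) = indicator A k - indicator A l.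
Proof.
apply/funext => i.
rewrite [RHS](_ : _ = indicator A k i - indicator A l i) // /indicator.
by case: ifP; rewrite ?subrr.
Qed.

(** A copy of [K] when [A] is nonempty; the test subgroup for the lower bound on the entropy. *)
Definition indicator_subgroup (A : set Gamma) : {fset Gamma -> K} :=
  [fset indicator A k | k : K]%fset.

Lemma indicator_subgroupP A y :
  reflect (exists k, y = indicator A k) (y \in indicator_subgroup A).
Proof.
apply: (iffP idP) => [/imfsetP[k _ ->]|[k ->]]; first by exists k.
by apply/imfsetP; exists k.
Qed.

Lemma finite_indicator_subgroup A : finite_subgroup (indicator_subgroup A).
Proof.
split=> [|_ _ /indicator_subgroupP[k ->] /indicator_subgroupP[l ->]].
  apply/indicator_subgroupP; exists 0.
  by rewrite -[X in indicator A X](subrr 0) indicatorB subrr.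
by apply/indicator_subgroupP; exists (k - l); rewrite indicatorB.
Qed.

Lemma card_indicator_subgroup A : A !=set0 -> #|` indicator_subgroup A| = #|K|.
Proof.
move=> [i Ai]; rewrite card_imfset /= ?cardE // => k l.
by move=> /(congr1 (@^~ i)); rewrite !indicatorT.
Qed.

Lemma periodic_shift : periodic_fun lambda -> periodic_fun shift.
Proof.
move=> [n [n_gt0 ln]]; exists n; split=> // x.
by apply/funext => i; rewrite iter_shiftE ln.
Qed.

(** The shift forgets the value at a point [i] outside the image of [lambda], so it kills all
    indicators of [{i}]. *)
Lemma surj_of_shift_inj : (1 < #|K|)%N -> injective shift ->
  forall i, exists j, lambda j = i.
Proof.
move=> /card_gt1P[k [l [_ _ /eqP nkl]]] shift_inj i; apply: contrapT => ni.
apply: nkl.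
rewrite -(@indicatorT [set i] k i) // -[RHS](@indicatorT [set i] l i) //.
congr (_ i); apply: shift_inj; apply/funext => j; rewrite /generalized_shift.
by rewrite !indicatorF // => lj; apply: ni; exists j.
Qed.

End Shift.

(** * Shifts for which all first hitting times occur *)

Section FirstHittingTimes.
Variables (Gamma : Type) (lambda : Gamma -> Gamma) (K : finZmodType).
Local Notation shift := (@generalized_shift Gamma K lambda).
Variable A : set Gamma.
Hypothesis K_nontrivial : (1 < #|K|)%N.
Hypothesis A_hit : forall n, exists i,
  A (iter n lambda i) /\ forall m, (m < n)%N -> ~ A (iter m lambda i).

Lemma shift_not_locally_periodic : ~ locally_periodic_fun shift.
Proof.
have /card_gt1P[k [l [_ _ /eqP nkl]]] := K_nontrivial.
move=> shift_lp; apply: nkl.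
suff k0 (k' : K) : k' = 0 by rewrite (k0 k) (k0 l).
have [n [n_gt0 shn]] := shift_lp (indicator A k').
(* At [i] the indicator is 0, because [n > 0], while its [n]-th iterate is [k']. *)
have [i [Ai nAi]] := A_hit n.
have := congr1 (@^~ i) shn; rewrite iter_shiftE indicatorT //.
by rewrite indicatorF //; exact: (nAi 0%N).
Qed.

(** Each summand of index below [n] vanishes at a point that has not yet hit [A]. *)
Lemma trajectory_indicator_vanish n m x i :
    (forall l, (l < n)%N -> ~ A (iter l lambda i)) -> (m <= n)%N ->
  x \in trajectory shift (indicator_subgroup K A) m -> x i = 0.
Proof.
move=> nAi; elim: m x => [|m IHm] x lemn; first by rewrite inE => /eqP ->.
case/trajectoryP => x' [_ [x'T /indicator_subgroupP[k ->] ->]].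
rewrite fctE iter_shiftE (IHm _ _ x'T) 1?ltnW // indicatorF ?addr0 //.
exact: nAi.
Qed.

Lemma shift_entropy_gt0 (R : realType) : (0 < algebraic_entropy R shift)%E.
Proof.
have A0 : A !=set0 by have [i [Ai _]] := A_hit 0; exists i.
apply: (@lt_le_trans _ _ (ln #|K|%:R)%:E).
  by rewrite lte_fin ln_gt0 // ltr1n.
apply: ereal_sup_ubound; exists (indicator_subgroup K A) => /=.
  exact: finite_indicator_subgroup.
congr EFin; apply: trajectory_entropy_exponential; first exact: ltnW.
rewrite -(card_indicator_subgroup K A0); apply: card_trajectory_direct.
move=> n x x' _ _ xT x'T /indicator_subgroupP[k ->] /indicator_subgroupP[l ->].
(* Evaluation at [i] kills both elements of [T_n] and leaves [k = l]. *)
have [i [Ai nAi]] := A_hit n.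
move=> /(congr1 (@^~ i)); rewrite !fctE !iter_shiftE !indicatorT //.
by rewrite !(trajectory_indicator_vanish nAi (leqnn n)) // !add0r => ->.
Qed.

End FirstHittingTimes.

Theorem corollary4p3 (R : realType) (Gamma : Type) (lambda : Gamma -> Gamma)
    (K : finZmodType) (K_nontrivial : (1 < #|K|)%N)
    (shift_inj : injective (@generalized_shift Gamma K lambda)) :
  (locally_periodic_fun (@generalized_shift Gamma K lambda) <->
     periodic_fun (@generalized_shift Gamma K lambda)) /\
  (periodic_fun (@generalized_shift Gamma K lambda) <->
     algebraic_entropy R (@generalized_shift Gamma K lambda) = 0%E).
Proof.
(* All three conditions hold if [lambda] is periodic, and all three fail otherwise. *)
have [lp|nlp] := pselect (periodic_fun lambda).
  have sp := periodic_shift K lp.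
  split; split=> // _; last exact: algebraic_entropy_periodic.
  by move=> x; have [n [n_gt0 sn]] := sp; exists n.
have [A A_hit] := all_first_hitting_times
  (surj_of_shift_inj K_nontrivial shift_inj) nlp.
have nslp := shift_not_locally_periodic K_nontrivial A_hit.
have nsp : ~ periodic_fun (@generalized_shift Gamma K lambda).
  by move=> [n [n_gt0 sn]]; apply: nslp => x; exists n.
split; split=> // ent0.
by have := shift_entropy_gt0 K_nontrivial A_hit R; rewrite ent0 ltxx.
Qed.
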